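(* Let $\tilde r(f,x)$ be the generalized Floater--Hormann interpolant corresponding to fixed parameters $d,\gamma\in\mathbb{N}$, $\gamma\ge2$, arbitrarily large $n\ge d$, and a distribution of nodes $a=x_0<x_1<\dots<x_n=b$ satisfying $h\sim h^*\sim n^{-1}$. For any $0<\alpha\le1$, if $f\in Lip_\alpha([a,b])$ then $$|f(x)-\tilde r(f,x)|\le C\begin{cases}\dfrac1{n^\alpha}&\text{if }\gamma>\alpha+1,\\[2mm]\dfrac{\log n}{n^\alpha}&\text{if }\gamma=\alpha+1,\end{cases}\qquad\forall x\in[a,b],$$ where $C>0$ is a constant independent of $n$ and $x$, bounded with respect to $\gamma>1$ but exponentially growing with $d$.
   Context: $\mathbb{N}=\{1,2,3,\ldots\}$. For nodes $a=x_0<\dots<x_n=b$ (depending on $n$), $h=\max_{0\le k<n}(x_{k+1}-x_k)$ and $h^*=\min_{0\le k<n}(x_{k+1}-x_k)$; $u\sim v$ means that the ratio $u/v$ lies between two absolute positive constants (independent of $n$). $Lip_\alpha([a,b])$ is the class of functions $f$ for which there is $M>0$ with $|f(x)-f(y)|\le M|x-y|^\alpha$ for all $x,y\in[a,b]$. For $i=0,\ldots,n-d$ let $p_i$ be the unique polynomial of degree $\le d$ interpolating $f$ at $x_i,\ldots,x_{i+d}$, and let $\tilde\lambda_i(x)=(-1)^{i\gamma}\prod_{j=i}^{i+d}(x-x_j)^{-\gamma}$. The generalized Floater--Hormann interpolant of $f$ is $$\tilde r(f,x)=\frac{\sum_{i=0}^{n-d}\tilde\lambda_i(x)p_i(x)}{\sum_{i=0}^{n-d}\tilde\lambda_i(x)},$$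 a rational function without real poles, with $\tilde r(f,x_k)=f(x_k)$ at the nodes. The constant $C$ may depend on $f$, $\alpha$, $[a,b]$ and the constants implicit in $h\sim h^*\sim n^{-1}$.
   Formalization: In the case γ = α+1 the bound with log n is stated for n ≥ 2 only: for n = d = 1, log n = 0 and the bound fails (for example f(x) = x² on [0,1], whose interpolant is linear). *)

(* Defs.v *)
From HB Require Import structures.
From mathcomp Require Import all_boot all_order all_algebra.
From mathcomp Require Import all_classical all_reals all_analysis.
Set Implicit Arguments.
Unset Strict Implicit.
Unset Printing Implicit Defensive.
Import Order.TTheory GRing.Theory Num.Theory.
Local Open Scope classical_set_scope.
Local Open Scope ring_scope.

(* Nodes are the values x 0, ..., x n of a sequence x : nat -> R; the values
   of x beyond n, and those of f outside [a, b], are never used. *)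

Section FloaterHormann.
Variable R : realType.
Implicit Types (a b alpha t : R) (f : R -> R) (x : nat -> R) (d g n i : nat).

Definition Lip alpha a b f : Prop :=
  exists2 M : R, 0 < M &
    forall s t, a <= s <= b -> a <= t <= b ->
      `|f s - f t| <= M * `|s - t| `^ alpha.

Definition nodes a b n x : Prop :=
  [/\ x 0%N = a, x n = b & forall k, (k < n)%N -> x k < x k.+1].

(* The neutral values 0 and x n - x 0 do not affect the maximum and minimum:
   for increasing nodes and 0 < n every gap lies between them. *)
Definition max_gap n x : R := \big[Num.max/0]_(k < n) (x k.+1 - x k).
Definition min_gap n x : R :=
  \big[Num.min/(x n - x 0%N)]_(k < n) (x k.+1 - x k).

(* u ~ v, with the two absolute constants made explicit. *)
Definition sim (c1 c2 u v : R) : Prop := c1 <= u / v <= c2.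

Definition interpolates d x f i (p : {poly R}) : Prop :=
  (size p <= d.+1)%N /\
  forall j, (i <= j <= i + d)%N -> p.[x j] = f (x j).

(* Definite description; see interpolates_local_interp and
   interpolates_unique below. *)
Definition local_interp d x f i : {poly R} :=
  xget 0 [set p | interpolates d x f i p].

Definition fh_weight d g x i t : R :=
  (-1) ^+ (i * g) * \prod_(i <= j < (i + d).+1) (t - x j) ^- g.

Definition fh_quotient d g n x f t : R :=
  (\sum_(0 <= i < (n - d).+1) fh_weight d g x i t * (local_interp d x f i).[t])
  / \sum_(0 <= i < (n - d).+1) fh_weight d g x i t.

(* The weights have poles at the nodes, which are removable singularities of
   the quotient: the rational function takes the value f (x k) at x k. Since
   0^-1 = 0 here, that value has to be given separately. *)
Definition fh_interpolant d g n x f t : R :=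
  if t \in [seq x k | k <- iota 0 n.+1] then f t else fh_quotient d g n x f t.

Definition bounded_in_gamma (C : nat -> nat -> R) : Prop :=
  forall d, (1 <= d)%N -> exists K : R, forall g, (2 <= g)%N -> C d g <= K.

(* Two-sided geometric growth in d, at rates that do not depend on gamma. *)
Definition exp_growing_in_d (C : nat -> nat -> R) : Prop :=
  exists K1 B1 K2 B2 : R, [/\ 0 < K1, 1 < B1, 0 < K2, 1 < B2 &
    forall d g, (1 <= d)%N -> (2 <= g)%N ->
      K1 * B1 ^+ d <= C d g <= K2 * B2 ^+ d].

Lemma nodes_inj a b n x : nodes a b n x ->
  forall j k, (j <= n)%N -> (k <= n)%N -> x j = x k -> j = k.
Proof.
case=> _ _ xS.
have lt_x j k : (j < k)%N -> (k <= n)%N -> x j < x k.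
  elim: k => // k IHk; rewrite ltnS leq_eqVlt => /predU1P[->|jk] kn.
    exact: xS.
  by rewrite (lt_trans (IHk jk (ltnW kn))) ?xS.
move=> j k jn kn xjk; case: (ltngtP j k) => // jk.
  by have := lt_x _ _ jk kn; rewrite xjk ltxx.
by have := lt_x _ _ jk jn; rewrite xjk ltxx.
Qed.

Lemma interpolates_unique a b d n x f i (p q : {poly R}) :
  nodes a b n x -> (i + d <= n)%N ->
  interpolates d x f i p -> interpolates d x f i q -> p = q.
Proof.
move=> xn idn [sp px] [sq qx]; apply/eqP; rewrite -subr_eq0; apply/eqP.
pose s := [seq x j | j <- iota i d.+1].
apply: (@roots_geq_poly_eq0 _ _ s).
- apply/allP => _ /mapP[j + ->]; rewrite mem_iota addnS ltnS => ij.
  by rewrite rootE !hornerE px // qx // subrr.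
- rewrite map_inj_in_uniq ?iota_uniq // => j k.
  rewrite !mem_iota addnS !ltnS => /andP[_ jd] /andP[_ kd].
  by apply: (nodes_inj xn); apply: leq_trans idn.
- rewrite size_map size_iota (leq_trans (size_polyD _ _)) //.
  by rewrite size_polyN geq_max sp sq.
Qed.

Lemma interpolates_exists a b d n x f i :
  nodes a b n x -> (i + d <= n)%N -> exists p, interpolates d x f i p.
Proof.
move=> xn; elim: d => [|d IHd] idn.
  exists (f (x i))%:P; split=> [|j]; first exact: size_polyC_leq1.
  by rewrite addn0 -eqn_leq => /eqP <-; rewrite hornerC.
have [|p [sp px]] := IHd; first by rewrite (leq_trans _ idn) // addnS.
pose s := [seq x j | j <- iota i d.+1].
pose w : {poly R} := \prod_(z <- s) ('X - z%:P).
have sw : size w = d.+2 by rewrite size_prod_XsubC size_map size_iota.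
have wx j : (i <= j <= i + d)%N -> w.[x j] = 0.
  move=> ij; apply/eqP; rewrite -[_ == _]/(root w _) root_prod_XsubC.
  by apply: map_f; rewrite mem_iota addnS ltnS.
pose e := x (i + d.+1)%N.
have we : w.[e] != 0.
  rewrite -[_ != 0]/(~~ root w _) root_prod_XsubC.
  apply/mapP => -[j]; rewrite mem_iota addnS ltnS => /andP[_ jd].
  have jn : (j <= n)%N by rewrite (leq_trans jd) // (leq_trans _ idn) // addnS.
  move=> /(nodes_inj xn idn jn) ej; by move: jd; rewrite -ej addnS ltnn.
exists (p + ((f e - p.[e]) / w.[e]) *: w); split.
  rewrite (leq_trans (size_polyD _ _)) // geq_max (leq_trans sp) //=.
  by rewrite -sw size_scale_leq.
move=> j /andP[ij]; rewrite leq_eqVlt => /predU1P[->|].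
  by rewrite hornerD hornerZ -/e divfK // addrC subrK.
rewrite addnS ltnS => jd.
have ijd : (i <= j <= i + d)%N by rewrite ij.
by rewrite hornerD hornerZ wx // px // mulr0 addr0.
Qed.

Lemma interpolates_local_interp a b d n x f i :
  nodes a b n x -> (i + d <= n)%N ->
  interpolates d x f i (local_interp d x f i).
Proof. by move=> xn idn; apply: xgetPex; exact: interpolates_exists xn idn. Qed.

End FloaterHormann.

(* Main.v *)
(* Let t lie strictly between x_k and x_(k+1), let P_i be the product of the
   distances from t to x_i, ..., x_(i+d), so that |lambda_i| = P_i^(-gamma),
   and let S be the sum of the lambda_i. The alternating pattern of the weights
   gives |S| >= c P_i^(-gamma) for every i, with c depending only on the mesh
   ratio; the Lagrange form of p_i and the Lipschitz condition bound
   |f(t) - p_i(t)| by P_i times a sum of the terms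
   |t - x_j|^(alpha-1) binom(d,j-i) / (d! h_*^d). Comparing with one window i0
   that contains x_k and x_(k+1), since gamma >= 2 the weight lambda_i / S turns
   the factor P_i into at most P_i0 min(1, P_i0 / P_i) / c. Now
   P_i0 |t - x_j|^(alpha-1) is of order h^(d+alpha), and since d >= 1 the ratios
   P_i0 / P_i decay quadratically in the distance of the window i to t, hence
   are summable. Thus the error is O(h^alpha) in both cases, uniformly in
   gamma. *)
Require Import Defs.
From mathcomp Require Import all_boot all_order all_algebra.
From mathcomp Require Import all_classical all_reals all_analysis.
From mathcomp Require Import qpoly zify ring lra.
Set Implicit Arguments.
Unset Strict Implicit.
Unset Printing Implicit Defensive.
Import Order.TTheory GRing.Theory Num.Theory.
Local Open Scope ring_scope.

(** * Factorials, telescoping sums and signed sums *)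

(** In truncated subtraction [(j - m) + (m - j)] is |j - m|. The indices below j contribute j!,
    those above contribute (d - j)!; the product is the Lagrange denominator at unit spacing. *)
Lemma prod_distn_neq d j : (j <= d)%N ->
  (\prod_(m < d.+1 | m != j :> nat) ((j - m) + (m - j)) = j`! * (d - j)`!)%N.
Proof.
elim: d => [|d IHd] jd.
  move: jd; rewrite leqn0 => /eqP ->; rewrite big1 // => m.
  by rewrite (ord1 m).
rewrite big_mkcond big_ord_recr -big_mkcond /=.
move: jd; rewrite leq_eqVlt => /predU1P[->|jd].
  rewrite eqxx /= muln1 subnn fact0 muln1 fact_prod big_add1 /= big_nat_rev /=.
  rewrite big_mkord; apply: eq_big => [m|m _].
    by rewrite neq_ltn ltn_ord.
  by have := ltn_ord m; lia.
rewrite IHd // ifT; last by apply/eqP; lia.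
by rewrite -mulnA (_ : d.+1 - j = (d - j).+1)%N ?factS; nia.
Qed.

Section RealSums.
Variable R : realFieldType.
Implicit Types (s rho p q : R) (a : nat -> R).

Lemma inv_pronic p : 0 < p -> (p * (p + 1))^-1 = p^-1 - (p + 1)^-1.
Proof. by move=> p0; field; rewrite !gt_eqF // ltr_wpDr. Qed.

(** The sum telescopes by [inv_pronic]. For [i <= K] the summand is 0^-1 = 0, so only indices on one
    side of [K] count. *)
Lemma sum_inv_pronic_right K N :
  \sum_(0 <= i < N) (((i - K) * (i - K).+1)%:R : R)^-1 <= 1.
Proof.
(* Since the predecessor of 0 is 0, this sharper bound is 0 as long as [N <= K]. *)
suff: \sum_(0 <= i < N) (((i - K) * (i - K).+1)%:R : R)^-1
      <= 1 - ((N - K).-1.+1)%:R^-1.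
  by move=> /le_trans; apply; rewrite gerBl invr_ge0.
elim: N => [|N IHN]; first by rewrite big_nil sub0n invr1 subrr.
rewrite big_nat_recr //=; apply: le_trans (lerD IHN (lexx _)) _.
have [NK|KN] := leqP N K.
  have -> : (N - K = 0)%N by lia.
  have -> : ((N.+1 - K).-1 = 0)%N by lia.
  by rewrite mul0n invr0 addr0.
have -> : (N.+1 - K = (N - K).+1)%N by lia.
case: (N - K)%N (subn_gt0 K N) => [|l _] /=; first by rewrite KN.
rewrite natrM -[l.+2%:R]natr1.
have := @inv_pronic l.+1%:R; rewrite ltr0n => /(_ isT) ->.
by rewrite addrA subrK.
Qed.

Lemma sum_inv_pronic_left K N :
  \sum_(0 <= i < N) (((K - i) * (K - i).+1)%:R : R)^-1 <= 1.
Proof.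
suff: \sum_(0 <= i < N) (((K - i) * (K - i).+1)%:R : R)^-1
      <= ((K - N).+1)%:R^-1.
  by move=> /le_trans; apply; rewrite invf_le1 ?ltr0n // ler1n.
elim: N => [|N IHN]; first by rewrite big_nil invr_ge0.
rewrite big_nat_recr //=; apply: le_trans (lerD IHN (lexx _)) _.
have -> : (K - N.+1 = (K - N).-1)%N by lia.
case: (K - N)%N => [|l] /=; first by rewrite mul0n invr0 addr0.
rewrite natrM -[l.+2%:R]natr1.
have := @inv_pronic l.+1%:R; rewrite ltr0n => /(_ isT) ->.
by rewrite addrC subrK.
Qed.

Lemma sum_window k d N :
  (\sum_(0 <= i < N) (k <= i + d <= k + d.+1) <= d.+2)%N.
Proof.
suff: (\sum_(0 <= i < N) (k <= i + d <= k + d.+1) <= minn (N + d - k) d.+2)%N.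
  by move=> /leq_trans; apply; rewrite geq_minr.
elim: N => [|N IHN]; first by rewrite big_nil.
by rewrite big_nat_recr //=; case: (boolP (_ <= _ <= _)%N) => /=; lia.
Qed.

(** Leibniz argument: behind the head stands minus the alternating sum of the shifted sequence,
    which by induction lies between 0 and [a 1]. *)
Lemma alternating_sum_bounds a : (forall i, 0 <= a i) ->
  (forall i, a i.+1 <= a i) ->
  forall N, 0 <= \sum_(0 <= i < N) (-1) ^+ i * a i <= a 0%N.
Proof.
move=> + + N; elim: N a => [|N IHN] a a0 aS; first by rewrite big_nil lexx a0.
rewrite big_nat_recl //= expr0 mul1r.
under eq_bigr do rewrite exprS mulN1r mulNr.
rewrite sumrN.
have /andP[] := IHN (a \o succn) (fun i => a0 i.+1) (fun i => aS i.+1).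
by move=> /=; have := aS 0%N; lra.
Qed.

Lemma signed_sum_ge0 s a : s = 1 \/ s = -1 -> (forall i, 0 <= a i) ->
  (forall i, a i.+1 <= a i) ->
  forall N, 0 <= \sum_(0 <= i < N) s ^+ i * a i.
Proof.
move=> [-> | ->] a0 aS N; last by have /andP[] := alternating_sum_bounds a0 aS N.
by apply: sumr_ge0 => i _; rewrite expr1n mul1r.
Qed.

(** The two values of [s] stand for the two parities of gamma. For [s = 1] the tail is nonnegative;
    for [s = -1] it costs at most [a 1], hence at most [rho * a 0]. *)
Lemma signed_sum_ge_head s rho a N : s = 1 \/ s = -1 -> (forall i, 0 <= a i) ->
  (forall i, a i.+1 <= a i) -> 0 <= rho -> ((0 < N)%N -> a 1%N <= rho * a 0%N) ->
  (1 - rho) * a 0%N <= \sum_(0 <= i < N.+1) s ^+ i * a i.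
Proof.
move=> s1 a0 aS rho0 a1.
rewrite big_nat_recl //= expr0 mul1r; under eq_bigr do rewrite exprS -mulrA.
rewrite -mulr_sumr mulrBl mul1r lerD2l.
case: N a1 => [_|N a1]; first by rewrite big_nil mulr0 oppr_le0 mulr_ge0.
have := alternating_sum_bounds (fun i => a0 i.+1) (fun i => aS i.+1) N.+1.
have := a1 isT.
case: s1 => ->; last by lra.
move=> _ _; rewrite mul1r; apply: (@le_trans _ _ 0); first by rewrite oppr_le0 mulr_ge0.
by apply: sumr_ge0 => i _; rewrite expr1n mul1r.
Qed.

(** Raising to the power g gives the factor rho^g, and rho^g <= rho because rho <= 1 and g > 0; the
    resulting factor is free of g. *)
Lemma invX_le_scale rho p q g : 0 < p -> p <= rho * q -> 0 <= rho <= 1 ->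
  0 < q -> (0 < g)%N -> q ^- g <= rho * p ^- g.
Proof.
move=> p0 pq /andP[rho0 rho1] q0; case: g => // g _.
rewrite ler_pdivlMr ?exprn_gt0 // mulrC ler_pdivrMr ?exprn_gt0 //.
apply: (@le_trans _ _ ((rho * q) ^+ g.+1)).
  by rewrite lerXn2r ?nnegrE // ?(le_trans _ pq) // ltW.
rewrite exprMn ler_wpM2r //; first by rewrite exprn_ge0 // ltW.
by rewrite exprS ler_piMr // exprn_ile1.
Qed.

End RealSums.

(** * Products of node counts over a window *)

(* The number of nodes strictly between [x m] and a point that lies between
   [x k] and [x k.+1]. *)
Definition nodes_between k m := ((k - m) + (m - k.+1))%N.

(** Induction on [e] removes an end of the range for which the hypothesis survives; the removed
    factor is at most the new length. *)
Lemma prod_nodes_between_le_fact k e i : (i <= k.+1 <= i + e)%N ->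
  (\prod_(i <= m < i + e) (nodes_between k m).+1 <= e`!)%N.
Proof.
rewrite /nodes_between; elim: e i => [|e IHe] i ike.
  by rewrite addn0 big_geq.
rewrite factS; have [ke|ke] := leqP k.+1 (i + e).
  rewrite addnS big_nat_recr /=; last by lia.
  by rewrite mulnC leq_mul ?IHe //; lia.
rewrite big_ltn; last by lia.
by rewrite addnS -addSn leq_mul ?IHe //; lia.
Qed.

(** The two nearest factors l and l + 1 keep the quadratic growth in l; the remaining ones are at
    least 2, ..., e + 1. Two factors are available since the window has [e.+2] nodes. *)
Lemma prod_nodes_between_right k l e :
  (l * l.+1 * e.+1`!
   <= \prod_(k.+1 + l <= m < k.+1 + l + e.+2) nodes_between k m)%N.
Proof.
rewrite /nodes_between; elim: e => [|e IHe].
  rewrite !addnS addn0 2?big_ltn ?big_geq ?muln1; [|lia..].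
  by rewrite leq_mul //; lia.
rewrite factS mulnCA mulnC addnS big_nat_recr /=; last by lia.
by rewrite leq_mul //; lia.
Qed.

Lemma prod_nodes_between_left k l e i : (i + e.+1 + l = k)%N ->
  (l * l.+1 * e.+1`! <= \prod_(i <= m < i + e.+2) nodes_between k m)%N.
Proof.
rewrite /nodes_between; elim: e i => [|e IHe] i iel.
  rewrite !addnS addn0 2?big_ltn ?big_geq ?muln1; [|lia..].
  by rewrite mulnC leq_mul //; lia.
rewrite factS mulnCA big_ltn; last by lia.
rewrite leq_mul //; first by lia.
by rewrite addnS -addSn IHe //; lia.
Qed.

(** * Distances from t to the nodes, and their products over windows *)

Section NodeDistances.
Variables (R : realFieldType) (x : nat -> R) (dl h t : R) (k : nat).
Hypothesis dl_gt0 : 0 < dl.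
Hypothesis gap_ge : forall m, dl <= x m.+1 - x m.
Hypothesis gap_le : forall m, x m.+1 - x m <= h.
Hypothesis tk : x k < t < x k.+1.

Let h_gt0 : 0 < h.
Proof. exact: lt_le_trans dl_gt0 (le_trans (gap_ge 0) (gap_le 0)). Qed.

Lemma spacing_bounds p q : (p <= q)%N ->
  (q - p)%:R * dl <= x q - x p <= (q - p)%:R * h.
Proof.
move=> /subnK <-; rewrite addnK; elim: (q - p)%N => [|l].
  by rewrite add0n subrr !mul0r lexx.
have := gap_ge (l + p); have := gap_le (l + p).
by rewrite addSn -natr1 !mulrDl !mul1r => ? ? /andP[? ?]; apply/andP; split; lra.
Qed.

Lemma spaced_inj : injective x.
Proof.
move=> p q; wlog pq : p q / (p <= q)%N.
  by case: (leqP p q) => [|/ltnW] pq W xpq; [|symmetry]; apply: W.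
move=> xpq; have /andP[+ _] := spacing_bounds pq.
rewrite xpq subrr pmulr_lle0 // lern0 subn_eq0 => qp.
by apply/eqP; rewrite eqn_leq pq.
Qed.

Lemma node_sign m : t - x m = (-1) ^+ (k < m)%N * `|t - x m|.
Proof.
case/andP: tk => xk xk1; case: ltnP => km; rewrite ?expr1 ?expr0 ?mul1r ?mulN1r.
  rewrite ltr0_norm ?opprK // subr_lt0.
  have /andP[+ _] := spacing_bounds km.
  have : 0 <= (m - k.+1)%:R * dl by rewrite mulr_ge0 // ltW.
  by lra.
rewrite ger0_norm // subr_ge0.
have /andP[+ _] := spacing_bounds km.
have : 0 <= (k - m)%:R * dl by rewrite mulr_ge0 // ltW.
by lra.
Qed.

Lemma node_dist_bounds m :
  (nodes_between k m)%:R * dl <= `|t - x m| <= (nodes_between k m).+1%:R * h.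
Proof.
case/andP: tk => xk xk1; rewrite /nodes_between -natr1 mulrDl mul1r.
have := gap_le k; have := node_sign m; case: ltnP => km.
  have /eqP -> : (k - m == 0)%N by rewrite subn_eq0 ltnW.
  have := spacing_bounds km.
  by rewrite add0n expr1 mulN1r => /andP[? ?] ? ?; apply/andP; split; lra.
have /eqP -> : (m - k.+1 == 0)%N by rewrite subn_eq0 leqW.
have := spacing_bounds km.
by rewrite addn0 expr0 mul1r => /andP[? ?] ? ?; apply/andP; split; lra.
Qed.

Lemma node_dist_gt0 m : 0 < `|t - x m|.
Proof.
case/andP: tk => xk xk1; rewrite normr_gt0 subr_eq0.
case: (ltngtP m k) => [mk|km|->]; last by rewrite gt_eqF.
- have /andP[+ _] := spacing_bounds (ltnW mk).
  have : 0 <= (k - m)%:R * dl by rewrite mulr_ge0 // ltW.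
  by move=> ? ?; rewrite gt_eqF //; lra.
have /andP[+ _] := spacing_bounds km.
have : 0 <= (m - k.+1)%:R * dl by rewrite mulr_ge0 // ltW.
by move=> ? ?; rewrite lt_eqF //; lra.
Qed.

Lemma node_dist_ge_gap m : m != k -> m != k.+1 -> dl <= `|t - x m|.
Proof.
move=> mk mk1; have /andP[+ _] := node_dist_bounds m; apply: le_trans.
by rewrite ler_peMl ?(ltW dl_gt0) // ler1n /nodes_between; lia.
Qed.

Definition window_prod d i := \prod_(i <= m < (i + d).+1) `|t - x m|.

Lemma window_prod_gt0 d i : 0 < window_prod d i.
Proof. by apply: prodr_gt0 => m _; exact: node_dist_gt0. Qed.

(** Both sides are the product over all nodes of two neighbouring windows, so comparing these
    windows amounts to comparing their two outer nodes. *)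
Lemma window_prod_shift d i :
  window_prod d i * `|t - x (i + d).+1| = `|t - x i| * window_prod d i.+1.
Proof.
rewrite /window_prod addSn -big_nat_recr /=; last by lia.
by rewrite big_ltn //; lia.
Qed.

Lemma window_prod_scale d i rho :
  `|t - x i| <= rho * `|t - x (i + d).+1| ->
  window_prod d i <= rho * window_prod d i.+1.
Proof.
move=> xi; rewrite -(ler_pM2r (node_dist_gt0 (i + d).+1)) window_prod_shift.
by rewrite mulrAC ler_wpM2r // ltW // window_prod_gt0.
Qed.

Lemma window_prod_scale_rev d i rho :
  `|t - x (i + d).+1| <= rho * `|t - x i| ->
  window_prod d i.+1 <= rho * window_prod d i.
Proof.
move=> xi; rewrite -(ler_pM2l (node_dist_gt0 i)) -window_prod_shift.
by rewrite mulrC mulrCA mulrA ler_wpM2r // ltW // window_prod_gt0.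
Qed.

Lemma window_prod_le d i : (i <= k.+1 <= i + d.+1)%N ->
  window_prod d i <= h ^+ d.+1 * d.+1`!%:R.
Proof.
move=> /prod_nodes_between_le_fact nb.
apply: (@le_trans _ _ (\prod_(i <= m < (i + d).+1)
    ((nodes_between k m).+1%:R * h))).
  apply: ler_prod => m _; rewrite normr_ge0 /=.
  by have /andP[] := node_dist_bounds m.
rewrite big_split /= prodr_const_nat -natr_prod mulrC.
rewrite (_ : (i + d).+1 - i = d.+1)%N; last by lia.
by rewrite ler_wpM2l ?exprn_ge0 // ?(ltW h_gt0) // ler_nat -addnS.
Qed.

(** The distance from t to x_k or x_(k+1) has no positive lower bound, so its reciprocal is
    controlled only by cancelling it against a factor of a window that contains both nodes. *)
Lemma window_prod_div_le d i j : (i <= k)%N -> (k < i + d)%N ->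
  j = k \/ j = k.+1 ->
  window_prod d i / `|t - x j| <= h ^+ d * d.+1`!%:R.
Proof.
move=> ik kd jk.
have ji : j \in index_iota i (i + d).+1 by rewrite mem_index_iota; lia.
rewrite /window_prod (bigD1_seq j) ?iota_uniq //= mulrAC divff ?mul1r; last first.
  by rewrite gt_eqF // node_dist_gt0.
apply: (@le_trans _ _ (\prod_(i <= m < (i + d).+1 | m != j)
    ((nodes_between k m).+1%:R * h))).
  apply: ler_prod => m _; rewrite normr_ge0 /=.
  by have /andP[] := node_dist_bounds m.
rewrite big_split /= -natr_prod mulrC big_const_seq iter_mulr_1.
have -> : count (fun m => m != j) (index_iota i (i + d).+1) = d.
  have := count_predC (pred1 j) (index_iota i (i + d).+1).
  rewrite count_uniq_mem ?iota_uniq // ji size_iota.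
  rewrite (_ : (i + d).+1 - i = d.+1)%N; last by lia.
  by rewrite add1n => -[].
rewrite ler_wpM2l ?exprn_ge0 // ?(ltW h_gt0) // ler_nat.
have := @prod_nodes_between_le_fact k d.+1 i.
rewrite addnS (bigD1_seq j) ?iota_uniq //=.
rewrite {1}/nodes_between (_ : (k - j + (j - k.+1)) = 0)%N ?mul1n; last by lia.
by apply; lia.
Qed.

Lemma window_prod_ge d i l : (0 < d)%N ->
  i = (k.+1 + l)%N \/ (i + d + l = k)%N ->
  dl ^+ d.+1 * (l * l.+1 * d`!)%:R <= window_prod d i.
Proof.
case: d => // d _ il.
apply: (@le_trans _ _ (\prod_(i <= m < (i + d.+1).+1)
    ((nodes_between k m)%:R * dl))); last first.
  apply: ler_prod => m _; rewrite mulr_ge0 ?ler0n ?(ltW dl_gt0) //=.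
  by have /andP[] := node_dist_bounds m.
rewrite big_split /= prodr_const_nat -natr_prod mulrC.
rewrite (_ : (i + d.+1).+1 - i = d.+2)%N; last by lia.
rewrite ler_wpM2r ?exprn_ge0 // ?(ltW dl_gt0) // ler_nat -addnS.
by case: il => [->|il]; [exact: prod_nodes_between_right | exact: prod_nodes_between_left].
Qed.

End NodeDistances.

(** * Signs of the weights and a lower bound for the denominator *)

Section Denominator.
Variables (R : realType) (x : nat -> R) (dl H t : R) (k d g : nat).
Hypothesis dl_gt0 : 0 < dl.
Hypothesis H_ge0 : 0 <= H.
Hypothesis gap_ge : forall m, dl <= x m.+1 - x m.
Hypothesis gap_le : forall m, x m.+1 - x m <= H * dl.
Hypothesis tk : x k < t < x k.+1.
Hypothesis g_gt0 : (0 < g)%N.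

Let P := window_prod x t d.
Let P_gt0 i : 0 < P i.
Proof. exact: (window_prod_gt0 dl_gt0 gap_ge gap_le tk). Qed.
Let sg : R := (-1) ^+ g.

Lemma sum_nodes_above i e :
  (\sum_(i <= m < i + e) (k < m) = i + e - maxn i k.+1)%N.
Proof.
elim: e => [|e IHe]; first by rewrite addn0 big_geq //; lia.
by rewrite addnS big_nat_recr ?leq_addr //= IHe; lia.
Qed.

(** Besides (-1)^(i gamma), every node of the window to the right of t contributes one (-1)^gamma;
    the truncated difference counts these nodes. *)
Lemma fh_weight_sign i :
  fh_weight d g x i t
  = sg ^+ (i + (i + d.+1 - maxn i k.+1)) * P i ^- g.
Proof.
rewrite /fh_weight prodfV prodrXl.
rewrite (eq_bigr (fun m => (-1) ^+ (k < m)%N * `|t - x m|)); last first.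
  by move=> m _; exact: (node_sign dl_gt0 gap_ge gap_le tk).
rewrite big_split /= prodrXr -addnS sum_nodes_above.
rewrite exprMn invfM mulrA; congr (_ * _); last by rewrite addnS.
rewrite -exprM -exprVn invrN1 -exprD -mulnDl.
by rewrite /sg -exprM mulnC.
Qed.

Lemma norm_fh_weight i : `|fh_weight d g x i t| = P i ^- g.
Proof.
rewrite fh_weight_sign normrM !normrX normrN1 !expr1n mul1r ger0_norm //.
by rewrite invr_ge0 exprn_ge0 // ltW // P_gt0.
Qed.

Let sg_cases : sg = 1 \/ sg = -1.
Proof. by rewrite /sg -signr_odd; case: odd; [right | left]. Qed.

Let sg_even e : ~~ odd e -> sg ^+ e = 1.
Proof. by move=> e0; rewrite /sg (exprAC _ g) -(signr_odd _ e) (negbTE e0) expr0 expr1n. Qed.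

Let sg_parity e f : odd e = odd f -> sg ^+ e = sg ^+ f.
Proof.
by move=> ef; rewrite /sg !(exprAC _ g) -(signr_odd _ e) ef signr_odd.
Qed.

(** For a window meeting {x_k, x_(k+1)} the factor [sg ^+ (d + k)] completes the exponent to the
    even number 2 (i + d). For windows lying l steps beyond these on either side the parity of l is
    left. *)
Let T i := sg ^+ (d + k) * fh_weight d g x i t.

Let T_right l : T (l + k.+1) = sg ^+ l * P (l + k.+1) ^- g.
Proof.
rewrite /T fh_weight_sign mulrA -exprD; congr (_ * _); apply: sg_parity.
by rewrite (_ : maxn _ _ = l + k.+1)%N; lia.
Qed.

Let T_left i l : (i + d + l = k)%N -> T i = sg ^+ l * P i ^- g.
Proof.
move=> il; rewrite /T fh_weight_sign mulrA -exprD; congr (_ * _).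
by apply: sg_parity; lia.
Qed.

Let T_mid i : (i <= k.+1)%N -> (k <= i + d)%N -> T i = P i ^- g.
Proof.
move=> ik kd; rewrite /T fh_weight_sign mulrA -exprD sg_even ?mul1r //.
by lia.
Qed.

Let a_ge0 i : 0 <= P i ^- g.
Proof. by rewrite invr_ge0 exprn_ge0 // ltW. Qed.

Let dist_le m q : (m <= q < k.+1)%N || (k < q <= m)%N ->
  `|t - x q| <= `|t - x m|.
Proof.
move=> mq; have := node_sign dl_gt0 gap_ge gap_le tk m.
have := node_sign dl_gt0 gap_ge gap_le tk q.
case/orP: mq => mq.
  have [mk qk] : ((k < m) = false /\ (k < q) = false)%N by split; lia.
  rewrite mk qk expr0 !mul1r => <- <-; rewrite lerD2l lerN2.
  have /andP[+ _] := spacing_bounds gap_ge gap_le (p := m) (q := q) ltac:(lia).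
  by move=> /(le_trans _); rewrite -subr_ge0; apply; rewrite mulr_ge0 // ltW.
have [mk qk] : ((k < m) = true /\ (k < q) = true)%N by split; lia.
rewrite mk qk expr1 !mulN1r => qe me; rewrite -lerN2 -qe -me lerD2l lerN2.
have /andP[+ _] := spacing_bounds gap_ge gap_le (p := q) (q := m) ltac:(lia).
by move=> /(le_trans _); rewrite -subr_ge0; apply; rewrite mulr_ge0 // ltW.
Qed.

(** This is the maximum of u / (dl + u) for 0 <= u <= H dl. Here u is the distance to the nearest
    node on one side of t, and dl + u bounds from below the distance to any farther node on that
    side. *)
Let rho := H / (H + 1).

Let H1 : 0 < H + 1. Proof. by rewrite ltr_wpDl. Qed.

Let rho_itv : 0 <= rho <= 1.
Proof.
rewrite /rho divr_ge0 ?(ltW H1) //= ler_pdivrMr // mul1r.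
by rewrite lerDl.
Qed.

Let oneBrho : 1 - rho = (H + 1)^-1.
Proof. by rewrite /rho; field; rewrite gt_eqF. Qed.

(* [rho] does not depend on [g]: this keeps the lower bound on the denominator
   uniform in [g]. *)
Let dist_ratio m q : (m < q)%N && (q == k) || (q == k.+1) && (q < m)%N ->
  `|t - x q| <= rho * `|t - x m|.
Proof.
move=> mq; have qle : `|t - x q| <= H * dl.
  have /andP[_] := node_dist_bounds dl_gt0 gap_ge gap_le tk q.
  rewrite (_ : nodes_between k q = 0)%N ?mul1r // /nodes_between.
  by case/orP: mq => /andP[] => [_ /eqP ->|/eqP -> _]; lia.
suff: dl + `|t - x q| <= `|t - x m|.
  move=> mle; rewrite /rho mulrAC ler_pdivlMr //.
  apply: (@le_trans _ _ (H * (dl + `|t - x q|))); first by rewrite mulrDr; lra.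
  exact: ler_wpM2l.
have := node_sign dl_gt0 gap_ge gap_le tk m.
have := node_sign dl_gt0 gap_ge gap_le tk q.
case/orP: mq => /andP[].
  move=> /[swap] /eqP -> mk.
  have -> : (k < m = false)%N by lia.
  rewrite ltnn expr0 !mul1r => <- <-.
  have /andP[+ _] := spacing_bounds gap_ge gap_le (ltnW mk).
  have : dl <= (k - m)%:R * dl by rewrite ler_peMl ?(ltW dl_gt0) // ler1n subn_gt0.
  by lra.
move=> /eqP -> mk; rewrite ltnSn (ltnW mk) expr1 !mulN1r => qe me.
have /andP[+ _] := spacing_bounds gap_ge gap_le (ltnW mk).
have : dl <= (m - k.+1)%:R * dl.
  by rewrite ler_peMl ?(ltW dl_gt0) // ler1n subn_gt0.
by lra.
Qed.

Let a_scale_right i r : 0 <= r <= 1 ->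
  `|t - x i| <= r * `|t - x (i + d).+1| -> P i.+1 ^- g <= r * P i ^- g.
Proof.
move=> r01 xr; apply: invX_le_scale => //.
exact: (window_prod_scale dl_gt0 gap_ge gap_le tk).
Qed.

Let a_scale_left i r : 0 <= r <= 1 ->
  `|t - x (i + d).+1| <= r * `|t - x i| -> P i ^- g <= r * P i.+1 ^- g.
Proof.
move=> r01 xr; apply: invX_le_scale => //.
exact: (window_prod_scale_rev dl_gt0 gap_ge gap_le tk).
Qed.

Let right l := P (l + k.+1) ^- g.

Let right_dec l : right l.+1 <= right l.
Proof.
rewrite -[leRHS]mul1r /right addSn; apply: a_scale_right.
  by rewrite ler01 lexx.
by rewrite mul1r; apply: dist_le; lia.
Qed.

Let right_le l : right l <= right 0.
Proof. by elim: l => // l /(le_trans _); apply. Qed.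

Let sum_right_ge0 N : 0 <= \sum_(0 <= l < N) T (l + k.+1).
Proof.
under eq_bigr do rewrite T_right.
by apply: signed_sum_ge0 => // l; exact: a_ge0.
Qed.

Let sum_right_ge N :
  (H + 1)^-1 * right 0 <= \sum_(0 <= l < N.+1) T (l + k.+1).
Proof.
under eq_bigr do rewrite T_right.
rewrite -oneBrho; apply: (signed_sum_ge_head (a := right)) => //.
- by move=> l; exact: a_ge0.
- by case/andP: rho_itv.
(* The second window to the right trades x_(k+1), the nearest node on that side, for a farther
   one. *)
move=> _; rewrite /right addSn; apply: a_scale_right => //.
by apply: dist_ratio; lia.
Qed.

(** The windows are listed from [K] leftwards. Truncated subtraction makes the sequence constant
    after window 0, so it is nonincreasing at every [l]. *)
Let left K l := P (K - l) ^- g.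

Let left_dec K l : (K + d = k)%N -> left K l.+1 <= left K l.
Proof.
move=> Kd; have [Kl|lK] := leqP K l.
  by rewrite /left (_ : K - l.+1 = K - l)%N //; lia.
rewrite -[leRHS]mul1r /left (_ : K - l = (K - l.+1).+1)%N; last by lia.
apply: a_scale_left; first by rewrite ler01 lexx.
by rewrite mul1r; apply: dist_le; lia.
Qed.

Let left_le K l : (K + d = k)%N -> left K l <= left K 0.
Proof. by move=> Kd; elim: l => // l /(le_trans _); apply; exact: left_dec. Qed.

Let sum_left_ge K : (K + d = k)%N ->
  (H + 1)^-1 * left K 0 <= \sum_(0 <= i < K.+1) T i.
Proof.
move=> Kd; rewrite big_nat_rev big_nat.
rewrite (eq_bigr (fun l => sg ^+ l * left K l)); last first.
  move=> l /andP[_ lK]; rewrite (@T_left _ l); last by lia.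
  by congr (_ * P _ ^- g); lia.
rewrite -big_nat -oneBrho; apply: (signed_sum_ge_head (a := left K)) => //.
- by move=> l; exact: a_ge0.
- by move=> l; exact: left_dec.
- by case/andP: rho_itv.
case: K Kd => // K Kd _; rewrite /left subSS !subn0.
by apply: a_scale_left => //; apply: dist_ratio; lia.
Qed.

(* Up to one global sign, the weights of the windows that meet {x_k, x_(k+1)}
   are positive, and on each side of them the weights either all are positive
   or alternate, starting with a positive one, and decrease. *)
Lemma sum_fh_weight_ge N i : (k < N + d)%N -> (i < N)%N ->
  (H + 1)^-1 * P i ^- g <= `|\sum_(0 <= i < N) fh_weight d g x i t|.
Proof.
move=> kN iN.
have -> : `|\sum_(0 <= i < N) fh_weight d g x i t| = `|\sum_(0 <= i < N) T i|.
  rewrite -mulr_sumr normrM normrX.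
  by case: sg_cases => ->; rewrite ?normrN normr1 expr1n mul1r.
apply: le_trans (ler_norm _).
(* Windows before [L] end at x_k or earlier, windows from [U] on start at x_(k+1) or later, and
   those in between contain both nodes. Truncation gives [L = 0] when no window lies to the left. *)
pose L := (k.+1 - d)%N; pose U := minn k.+1 N.
have c0 : 0 < (H + 1)^-1 by rewrite invr_gt0.
have c1 : (H + 1)^-1 <= 1 by rewrite invf_le1 // lerDr.
rewrite (@big_cat_nat _ _ _ L) //=; last by clear -kN; lia.
rewrite (@big_cat_nat _ _ _ U L) //=; [|by clear -kN; lia..].
have mid_ge0 j : (L <= j < U)%N -> 0 <= T j.
  by move=> jU; rewrite T_mid ?a_ge0 //; clear -jU; lia.
have sum_mid : 0 <= \sum_(L <= j < U) T j.
  by rewrite big_nat; apply: sumr_ge0 => j; exact: mid_ge0.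
(* The boolean factor combines two facts: the left part is nonnegative, and it dominates the weight
   of window [i] when [i] belongs to it. *)
have sum_left : (i < L)%N%:R * ((H + 1)^-1 * P i ^- g) <= \sum_(0 <= j < L) T j.
  rewrite /L; case: (leqP d k) => dk; last first.
    by rewrite (_ : k.+1 - d = 0)%N ?big_geq ?mul0r //; clear -dk; lia.
  have Kd : (k - d + d = k)%N by clear -dk; lia.
  rewrite (_ : k.+1 - d = (k - d).+1)%N; last by clear -dk; lia.
  apply: le_trans (sum_left_ge Kd); case: ltnP => iL; last first.
    by rewrite mul0r mulr_ge0 ?a_ge0 ?ltW.
  rewrite mul1r ler_wpM2l ?(ltW c0) //.
  have := left_le (k - d - i) Kd; rewrite /left.
  by rewrite (_ : (k - d - (k - d - i)) = i)%N //; clear -iL; lia.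
have sum_right : (U <= i)%N%:R * ((H + 1)^-1 * P i ^- g)
                 <= \sum_(U <= j < N) T j.
  rewrite /U; case: (leqP N k.+1) => Nk.
    by rewrite big_geq // leqNgt iN mul0r.
  rewrite -[index_iota _ _]/(index_iota (0 + k.+1) N) big_addn.
  case: (leqP k.+1 i) => ki; last by rewrite mul0r sum_right_ge0.
  rewrite mul1r (_ : N - k.+1 = (N - k.+2).+1)%N; last by clear -Nk; lia.
  apply: le_trans (sum_right_ge (N - k.+2)%N); rewrite ler_wpM2l ?(ltW c0) //.
  by have := right_le (i - k.+1); rewrite /right subnK.
have := sum_left; case: (ltnP i L) => iL /=.
  rewrite mul1r; move: sum_right; rewrite leqNgt (_ : (i < U)%N); last first.
    by clear -iL iN; lia.
  by rewrite mul0r => r0 l0; lra.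
rewrite mul0r => left0; move: sum_right; case: (leqP U i) => Ui /=.
  by rewrite mul1r => r0; lra.
rewrite mul0r => right0.
have Ti : (H + 1)^-1 * P i ^- g <= T i.
  rewrite T_mid; [|by clear -Ui; lia|by clear -iL; lia].
  by rewrite ler_piMl ?a_ge0.
have : T i <= \sum_(L <= j < U) T j.
  rewrite (bigD1_seq i) ?iota_uniq ?mem_index_iota ?iL //= lerDl.
  rewrite big_seq_cond; apply: sumr_ge0 => j /andP[+ _].
  by rewrite mem_index_iota; exact: mid_ge0.
by move=> Tm; lra.
Qed.

End Denominator.

(** * Lagrange form of a polynomial on a window *)

Section LagrangeBound.
Variables (R : realType) (x : nat -> R) (dl h t : R) (k : nat).
Hypothesis dl_gt0 : 0 < dl.
Hypothesis gap_ge : forall m, dl <= x m.+1 - x m.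
Hypothesis gap_le : forall m, x m.+1 - x m <= h.
Hypothesis tk : x k < t < x k.+1.

Lemma prod_node_gaps_ge d i j : (j <= d)%N ->
  (j`! * (d - j)`!)%:R * dl ^+ d
  <= \prod_(m < d.+1 | m != j :> nat) `|x (i + j)%N - x (i + m)%N|.
Proof.
move=> jd; rewrite -prod_distn_neq // natr_prod.
have -> : dl ^+ d = \prod_(m < d.+1 | m != j :> nat) dl.
  rewrite prodr_const; congr (_ ^+ _).
  have jd1 : (j < d.+1)%N by [].
  have := cardC1 (Ordinal jd1); rewrite card_ord /= => cd; rewrite -[LHS]cd.
  by apply: eq_card => m; rewrite !inE.
rewrite -big_split; apply: ler_prod => m mj /=.
rewrite mulr_ge0 ?ler0n ?(ltW dl_gt0) //=.
have [mj'|jm] := leqP m j.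
  have := spacing_bounds gap_ge gap_le (p := i + m) (q := i + j) ltac:(lia).
  rewrite (_ : (j - m + (m - j)) = (i + j - (i + m)))%N; last by lia.
  by case/andP => /le_trans + _; apply; exact: ler_norm.
have := spacing_bounds gap_ge gap_le (p := i + j) (q := i + m) ltac:(lia).
rewrite (_ : (j - m + (m - j)) = (i + m - (i + j)))%N; last by lia.
by case/andP => /le_trans + _; apply; rewrite distrC; exact: ler_norm.
Qed.

(** The j-th Lagrange denominator is at least j! (d - j)! dl^d, whose reciprocal is the binomial
    coefficient over d! dl^d. *)
Lemma norm_horner_le d i (q : {poly R}) : (size q <= d.+1)%N ->
  `|q.[t]| <= window_prod x t d i * \sum_(j < d.+1)
     `|q.[x (i + j)%N]| / `|t - x (i + j)%N| * ('C(d, j)%:R / (d`!%:R * dl ^+ d)).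
Proof.
move=> sq; have yinj : injective (fun j => x (i + j)%N).
  by move=> p r /(spaced_inj dl_gt0 gap_ge gap_le)/addnI.
rewrite {1}(lagrange_gen (ltn0Sn d) yinj sq) horner_sum mulr_sumr.
apply: le_trans (ler_norm_sum _ _ _) _; apply: ler_sum => j _.
rewrite hornerM hornerC lagrangeE //= hornerM hornerC !horner_prod.
have prodE z : \prod_(m < d.+1 | m != j) ('X - (x (i + m)%N)%:P).[z]
               = \prod_(m < d.+1 | m != j) (z - x (i + m)%N).
  by apply: eq_bigr => m _; rewrite hornerXsubC.
rewrite !prodE.
rewrite !normrM normfV !normr_prod.
have jd : (j <= d)%N by rewrite -ltnS.
have -> : \prod_(m < d.+1 | m != j) `|t - x (i + m)%N|
          = window_prod x t d i / `|t - x (i + j)%N|.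
  rewrite /window_prod -addnS -[index_iota _ _]/(index_iota (0 + i) (i + d.+1)).
  rewrite big_addn addKn.
  rewrite (eq_bigr (fun m => `|t - x (i + m)%N|)); last by move=> m _; rewrite addnC.
  rewrite big_mkord [X in _ = X / _](bigD1 j) //= mulrAC divff ?mul1r //.
  by rewrite gt_eqF // (node_dist_gt0 dl_gt0 gap_ge gap_le tk).
have := prod_node_gaps_ge i jd; set Q := \prod_(m < _ | _) _ => Qge.
have binE : 'C(d, j)%:R / (d`!%:R * dl ^+ d)
            = ((j`! * (d - j)`!)%:R * dl ^+ d)^-1 :> R.
  rewrite -(bin_fact jd) natrM -mulrA invfM mulrA divff ?mul1r //.
  by rewrite pnatr_eq0 -lt0n bin_gt0.
have fact0 : 0 < (j`! * (d - j)`!)%:R * dl ^+ d.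
  by rewrite mulr_gt0 ?exprn_gt0 // ltr0n muln_gt0 !fact_gt0.
rewrite binE.
have -> : forall u v w y : R, v * (u / w * y) = u * (y * (v / w)).
  by move=> u v w y; ring.
apply: ler_wpM2l => //; apply: ler_wpM2r.
  by rewrite divr_ge0 // ltW // (window_prod_gt0 dl_gt0 gap_ge gap_le tk).
by rewrite lef_pV2 // posrE // (lt_le_trans fact0).
Qed.

End LagrangeBound.

(** If p <= p0, the bound by p^-g makes the weight ratio at most 1/c. If p > p0, the bound by p0^-g
    gives p (p0/p)^g / c, and g >= 2 with p0/p < 1 reduces this to p0 (p0/p) / c. *)
Lemma weight_ratio_le (R : realFieldType) (p p0 c D : R) g :
  0 < p -> 0 < p0 -> 0 < c -> (2 <= g)%N ->
  c * p ^- g <= D -> c * p0 ^- g <= D ->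
  p ^- g * p / D <= c^-1 * (p0 * Num.min 1 (p0 / p)).
Proof.
move=> p_gt0 p0_gt0 c0 g2 Dp Dp0.
have D0 : 0 < D by apply: lt_le_trans Dp; rewrite mulr_gt0 ?invr_gt0 ?exprn_gt0.
have [pp0|p0p] := leP p p0.
  rewrite minEle ler_pdivlMr // mul1r pp0 mulr1 mulrAC.
  apply: ler_pM => //.
  - by rewrite ltW // divr_gt0 // invr_gt0 exprn_gt0.
  - exact: ltW.
  by rewrite ler_pdivrMr // mulrC ler_pdivlMr // mulrC.
rewrite minEle ler_pdivlMr // mul1r (lt_geF p0p).
have -> : p0 * (p0 / p) = p * (p0 / p) ^+ 2.
  by field; rewrite gt_eqF.
have q1 : p0 / p <= 1 by rewrite ler_pdivrMr // mul1r ltW.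
apply: (@le_trans _ _ (c^-1 * (p * (p0 / p) ^+ g))); last first.
  rewrite !ler_wpM2l ?invr_ge0 ?(ltW c0) ?(ltW p_gt0) //.
  by apply: ler_wiXn2l => //; rewrite divr_ge0 // ltW.
rewrite mulrCA [p ^- g * p]mulrC -mulrA ler_wpM2l ?(ltW p_gt0) //.
rewrite expr_div_n mulrA [leRHS]mulrC ler_wpM2l ?invr_ge0 ?exprn_ge0 ?(ltW p_gt0) //.
move: Dp0; rewrite ler_pdivrMr ?exprn_gt0 // => Dp0.
by rewrite ler_pdivlMl // -[leLHS]/(c / D) ler_pdivrMr // mulrC.
Qed.

(** * Summation of the local errors *)

Section ErrorBound.
Variables (R : realType) (x : nat -> R) (dl H t : R) (k d : nat).
Hypothesis dl_gt0 : 0 < dl.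
Hypothesis H_ge1 : 1 <= H.
Hypothesis gap_ge : forall m, dl <= x m.+1 - x m.
Hypothesis gap_le : forall m, x m.+1 - x m <= H * dl.
Hypothesis tk : x k < t < x k.+1.
Hypothesis d_gt0 : (0 < d)%N.
Variable i0 : nat.
Hypothesis i0_le : (i0 <= k)%N.
Hypothesis i0_gt : (k < i0 + d)%N.

Let P := window_prod x t d.
Let P_gt0 i : 0 < P i.
Proof. exact: (window_prod_gt0 dl_gt0 gap_ge gap_le tk). Qed.

Let H_gt0 : 0 < H. Proof. exact: lt_le_trans H_ge1. Qed.
Let Hdl_gt0 : 0 < H * dl. Proof. exact: mulr_gt0. Qed.

(** For j = k or k + 1 the reciprocal distance cancels against a factor of [P i0]. Every other node
    is at distance at least dl, and u^(alpha - 1) does not increase with u because alpha <= 1. *)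
Lemma powR_div_window_prod_le (alpha : R) j : 0 < alpha <= 1 ->
  `|t - x j| `^ alpha / `|t - x j| * P i0
  <= H * (H * dl) ^+ d * d.+1`!%:R * (H * dl) `^ alpha.
Proof.
move=> /andP[alpha_gt0 alpha_le1].
have dist_gt0 := node_dist_gt0 dl_gt0 gap_ge gap_le tk j.
have dlH : dl <= H * dl by rewrite ler_peMl // ltW.
have fact_ge0 : 0 <= (H * dl) ^+ d * d.+1`!%:R.
  by rewrite mulr_ge0 ?exprn_ge0 // ltW.
have [jk|/norP[jk jk1]] := boolP ((j == k) || (j == k.+1)).
  have j_cases : j = k \/ j = k.+1 by case/orP: jk => /eqP; auto.
  have distH : `|t - x j| <= H * dl.
    have /andP[_] := node_dist_bounds dl_gt0 gap_ge gap_le tk j.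
    rewrite (_ : nodes_between k j = 0)%N ?mul1r // /nodes_between.
    by case: j_cases => ->; lia.
  rewrite mulrAC -[leLHS]mulrA [leLHS]mulrC; apply: ler_pM.
  - by rewrite divr_ge0 // ltW.
  - exact: powR_ge0.
  - have := window_prod_div_le dl_gt0 gap_ge gap_le tk i0_le i0_gt j_cases.
    by move=> /le_trans; apply; rewrite -mulrA ler_peMl.
  by apply: ge0_ler_powR; rewrite ?nnegrE // ltW.
have dldist := node_dist_ge_gap dl_gt0 gap_ge gap_le tk jk jk1.
have ratio_le : `|t - x j| `^ alpha / `|t - x j| <= dl `^ alpha / dl.
  rewrite ler_pdivrMr // -mulrA.
  have r_ge1 : 1 <= dl^-1 * `|t - x j| by rewrite ler_pdivlMl // mulr1.
  rewrite -{1}[`|t - x j|](mulVKf (lt0r_neq0 dl_gt0)).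
  rewrite powRM ?(ltW dl_gt0) ?(le_trans _ r_ge1) //.
  by rewrite ler_wpM2l ?powR_ge0 //; exact: ler1_powR.
apply: (@le_trans _ _ (dl `^ alpha / dl * ((H * dl) ^+ d.+1 * d.+1`!%:R))).
  apply: ler_pM ratio_le _.
  - by rewrite divr_ge0 ?powR_ge0 // ltW.
  - by rewrite ltW.
  by apply: (window_prod_le dl_gt0 gap_ge gap_le tk); lia.
have -> : dl `^ alpha / dl * ((H * dl) ^+ d.+1 * d.+1`!%:R)
    = H * (H * dl) ^+ d * d.+1`!%:R * dl `^ alpha.
  by rewrite exprS; field; rewrite gt_eqF.
apply: ler_wpM2l; first by rewrite -mulrA mulr_ge0 // ltW.
by apply: ge0_ler_powR; rewrite ?nnegrE // ltW.
Qed.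

Lemma window_ratio_le i l :
  i = (k.+1 + l)%N \/ (i + d + l = k)%N -> (0 < l)%N ->
  P i0 / P i <= H ^+ d.+1 * d.+1%:R * ((l * l.+1)%:R)^-1.
Proof.
move=> il l0; rewrite ler_pdivrMr //.
have := window_prod_le dl_gt0 gap_ge gap_le tk (d := d) (i := i0) ltac:(lia).
move=> /le_trans; apply.
have := window_prod_ge dl_gt0 gap_ge gap_le tk d_gt0 il => Pi.
have ll : 0 < (l * l.+1)%:R :> R by rewrite ltr0n muln_gt0 l0.
apply: (@le_trans _ _ (H ^+ d.+1 * d.+1%:R * ((l * l.+1)%:R)^-1 *
    (dl ^+ d.+1 * (l * l.+1 * d`!)%:R))).
  rewrite exprMn factS [(d.+1 * _)%:R]natrM [(l * l.+1 * _)%:R]natrM.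
  move: (_ `!%:R) (d.+1%:R) (_%:R) (H ^+ _) (dl ^+ _) ll => u v L X Y ll.
  by rewrite le_eqVlt; apply/orP; left; apply/eqP; field; rewrite gt_eqF.
by apply: ler_wpM2l Pi; rewrite !mulr_ge0 ?exprn_ge0 ?invr_ge0 // ltW.
Qed.

Lemma sum_window_ratio_le N :
  \sum_(0 <= i < N) Num.min 1 (P i0 / P i)
  <= d.+2%:R + 2 * (H ^+ d.+1 * d.+1%:R).
Proof.
pose A := H ^+ d.+1 * d.+1%:R.
have A_ge0 : 0 <= A by rewrite mulr_ge0 ?exprn_ge0 // ltW.
(* By 0^-1 = 0, [rgt] vanishes up to window k + 1 and [lft] from window k - d on, so both can be
   summed over all windows. The at most d + 2 windows in between are bounded by 1 each. *)
pose rgt i : R := (((i - k.+1) * (i - k.+1).+1)%:R)^-1.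
pose lft i : R := (((k - d - i) * (k - d - i).+1)%:R)^-1.
have rgt_ge0 i : 0 <= rgt i by rewrite invr_ge0.
have lft_ge0 i : 0 <= lft i by rewrite invr_ge0.
apply: (@le_trans _ _ (\sum_(0 <= i < N)
    ((k <= i + d <= k + d.+1)%N%:R + A * rgt i + A * lft i))).
  apply: ler_sum => i _.
  have Argt := mulr_ge0 A_ge0 (rgt_ge0 i).
  have Alft := mulr_ge0 A_ge0 (lft_ge0 i).
  have [mid|] := boolP (k <= i + d <= k + d.+1)%N.
    by rewrite ge_min; apply/orP; left; rewrite mulr1n -addrA lerDl addr_ge0.
  move=> far; rewrite ge_min; apply/orP; right; rewrite add0r.
  have [ki|ik] := ltnP k.+1 i.
    apply: le_trans (window_ratio_le (i := i) (l := i - k.+1) _ _) _.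
    - by left; clear -ki; lia.
    - by clear -ki; lia.
    by rewrite lerDl.
  apply: le_trans (window_ratio_le (i := i) (l := k - d - i) _ _) _.
  - by right; clear -far ik; lia.
  - by clear -far ik; lia.
  by rewrite lerDr.
rewrite !big_split /= -natr_sum -!mulr_sumr -addrA.
apply: lerD; first by rewrite ler_nat sum_window.
rewrite mulrDl mul1r; apply: lerD; apply: ler_piMr => //.
  exact: sum_inv_pronic_right.
exact: sum_inv_pronic_left.
Qed.

(* Since [1 <= d] and [2 <= g], the quotient of the weight of window [i] by the
   denominator decays at least quadratically in the distance of the window to
   [t], so that no logarithm appears even for [g = alpha + 1]. *)
Lemma quotient_error_le (alpha M : R) (f : R -> R) (p : nat -> {poly R}) N g :
  0 < alpha <= 1 -> 0 <= M -> (2 <= g)%N -> (i0 < N)%N ->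
  (forall i, (i < N)%N -> interpolates d x f i (p i)) ->
  (forall j, (j < N + d)%N ->
     `|f t - f (x j)| <= M * `|t - x j| `^ alpha) ->
  `|f t - (\sum_(0 <= i < N) fh_weight d g x i t * (p i).[t])
          / \sum_(0 <= i < N) fh_weight d g x i t|
  <= 4 * M * (H + 1) * H ^+ 2 * (8 * H ^+ 2) ^+ d * (H * dl) `^ alpha.
Proof.
move=> alpha_itv M_ge0 g2 i0N pP fL.
have g_gt0 : (0 < g)%N by exact: leq_trans g2.
set S := \sum_(0 <= i < N) fh_weight d g x i t.
have H1_gt0 : 0 < H + 1 by rewrite addr_gt0.
have S_ge i : (i < N)%N -> (H + 1)^-1 * P i ^- g <= `|S|.
  move=> iN; apply: (sum_fh_weight_ge dl_gt0 (ltW H_gt0) gap_ge gap_le tk g_gt0) => //.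
  by clear -i0N i0_gt; lia.
have S_gt0 : 0 < `|S|.
  by apply: lt_le_trans (S_ge _ i0N); rewrite mulr_gt0 ?invr_gt0 ?exprn_gt0.
have -> : f t - (\sum_(0 <= i < N) fh_weight d g x i t * (p i).[t]) / S
    = (\sum_(0 <= i < N) fh_weight d g x i t * (f t - (p i).[t])) / S.
  under [in RHS]eq_bigr do rewrite mulrBr.
  by rewrite sumrB -mulr_suml -/S mulrBl [S * _ / S]mulrAC divff ?mul1r // -normr_gt0.
rewrite normrM normfV ler_pdivrMr //.
apply: le_trans (ler_norm_sum _ _ _) _; rewrite -ler_pdivrMr // mulr_suml.
(* [E] is M times the one-node bound H (H dl)^d (d + 1)! (H dl)^alpha, times 2^d / (d! dl^d), the
   total of the binomial weights. *)
pose E := M * H ^+ d.+1 * d.+1%:R * 2 ^+ d * (H * dl) `^ alpha.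
have E_ge0 : 0 <= E by rewrite !mulr_ge0 ?exprn_ge0 ?powR_ge0 // ltW.
apply: (@le_trans _ _ (\sum_(0 <= i < N)
    ((H + 1) * E * Num.min 1 (P i0 / P i)))); last first.
  rewrite -mulr_sumr; apply: le_trans (ler_wpM2l _ (sum_window_ratio_le N)) _.
    by rewrite mulr_ge0 // ltW.
  (* The rate 8 H^2 collects three factors 2^d, namely the binomial total, d + 1 in [E] and d + 1 in
     the sum of the ratios, together with H^(d+1) from each of the last two. *)
  have d1 : d.+1%:R <= 2 ^+ d :> R by rewrite -natrX ler_nat ltn_expl.
  have H_X : 1 <= H ^+ d.+1 by rewrite exprn_ege1.
  have X2_ge0 : 0 <= 2 ^+ d :> R by rewrite exprn_ge0.
  have -> : 4 * M * (H + 1) * H ^+ 2 * (8 * H ^+ 2) ^+ d * (H * dl) `^ alpha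
      = (H + 1) * (M * H ^+ d.+1 * 2 ^+ d * 2 ^+ d * (H * dl) `^ alpha)
        * (4 * (2 ^+ d * H ^+ d.+1)).
    by rewrite (_ : 8 = 2 * 2 * 2 :> R) ?exprMn -?exprM ?exprSr; [ring|ring].
  apply: ler_pM.
  - by rewrite mulr_ge0 // ltW.
  - by rewrite addr_ge0 // !mulr_ge0 ?exprn_ge0 // ltW.
  - rewrite ler_wpM2l ?(ltW H1_gt0) // ler_wpM2r ?powR_ge0 //.
    rewrite ler_wpM2r // ler_wpM2l // mulr_ge0 // exprn_ge0 // ltW //.
  have le2 : d.+2%:R <= 2 * (2 ^+ d * H ^+ d.+1).
    apply: (@le_trans _ _ (2 * 2 ^+ d)); last first.
      by rewrite ler_wpM2l // ler_peMr.
    rewrite -natr1; have : (1 : R) <= 2 ^+ d by rewrite exprn_ege1 // ler1n.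
    by lra.
  have : H ^+ d.+1 * d.+1%:R <= 2 ^+ d * H ^+ d.+1.
    by rewrite mulrC ler_wpM2r // exprn_ge0 // ltW.
  by lra.
rewrite big_nat [leRHS]big_nat; apply: ler_sum => i /= iN.
rewrite normrM (norm_fh_weight _ dl_gt0 (ltW H_gt0) gap_ge gap_le tk g_gt0) -/(P i).
have err : `|f t - (p i).[t]| <= P i * (E / P i0).
  have [sp px] := pP i iN.
  (* The Lagrange form is applied to the constant f(t) minus p_i: its value at t is the local error,
     its values at the nodes are f(t) - f(x_j). *)
  have sq : (size ((f t)%:P - p i)%R <= d.+1)%N.
    rewrite (leq_trans (size_polyD _ _)) // geq_max size_polyN sp andbT.
    by rewrite (leq_trans (size_polyC_leq1 _)).
  have := norm_horner_le dl_gt0 gap_ge gap_le tk i sq.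
  rewrite hornerD hornerN hornerC -/(P i) => /le_trans; apply.
  rewrite ler_wpM2l ?(ltW (P_gt0 i)) // ler_pdivlMr // mulr_suml.
  have dlX_gt0 : 0 < d`!%:R * dl ^+ d by rewrite mulr_gt0 ?exprn_gt0 // ltr0n fact_gt0.
  pose B := H * (H * dl) ^+ d * d.+1`!%:R * (H * dl) `^ alpha.
  apply: (@le_trans _ _ (\sum_(j < d.+1) (M * B * ('C(d, j)%:R / (d`!%:R * dl ^+ d))))).
    apply: ler_sum => j _; rewrite mulrAC ler_wpM2r ?divr_ge0 ?(ltW dlX_gt0) //.
    rewrite hornerD hornerN hornerC px; last by have := ltn_ord j; lia.
    apply: le_trans (_ : M * (`|t - x (i + j)%N| `^ alpha / `|t - x (i + j)%N| * P i0) <= _).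
      rewrite !mulrA ler_wpM2r ?(ltW (P_gt0 i0)) // ler_wpM2r ?invr_ge0 //.
      by apply: fL; clear -iN j; have := ltn_ord j; lia.
    by rewrite ler_wpM2l // powR_div_window_prod_le.
  rewrite -mulr_sumr -mulr_suml -natr_sum.
  have -> : (\sum_(j < d.+1) 'C(d, j) = 2 ^ d)%N.
    rewrite -[2%N]/(1 + 1)%N expnDn; apply: eq_bigr => j _.
    by rewrite !exp1n !muln1.
  rewrite natrX le_eqVlt; apply/orP; left; apply/eqP.
  rewrite /B /E exprMn factS natrM exprS; field.
  by rewrite expf_neq0 ?(gt_eqF dl_gt0) // pnatr_eq0 -lt0n fact_gt0.
apply: (@le_trans _ _ (P i ^- g * P i / `|S| * (E / P i0))).
  rewrite [leLHS]mulrAC [P i ^- g * _ / _]mulrAC -[leRHS]mulrA ler_wpM2l //.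
  by rewrite divr_ge0 ?invr_ge0 ?exprn_ge0 // ltW.
have := weight_ratio_le (P_gt0 i) (P_gt0 i0) _ g2 (S_ge _ iN) (S_ge _ i0N).
rewrite invr_gt0 invrK => /(_ H1_gt0) w_le.
apply: (@le_trans _ _ ((H + 1) * (P i0 * Num.min 1 (P i0 / P i)) * (E / P i0))).
  by rewrite ler_wpM2r // divr_ge0 // ltW.
rewrite le_eqVlt; apply/orP; left; apply/eqP; set w := Num.min _ _.
by field; rewrite gt_eqF.
Qed.

End ErrorBound.

(** * From finite node sets to the error bound in terms of n *)

Section Nodes.
Variable R : realType.
Implicit Types (a b t : R) (x : nat -> R) (n k : nat).

Lemma min_gap_le n x k : (k < n)%N -> min_gap n x <= x k.+1 - x k.
Proof. by move=> kn; exact: (bigmin_le _ (Ordinal kn)). Qed.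

Lemma max_gap_ge n x k : (k < n)%N -> x k.+1 - x k <= max_gap n x.
Proof. by move=> kn; exact: (le_bigmax _ _ (Ordinal kn)). Qed.

Lemma min_gap_gt0 a b n x : a < b -> nodes a b n x -> 0 < min_gap n x.
Proof.
move=> ab [xa xb xS]; apply: lt_bigmin; first by rewrite xa xb subr_gt0.
by move=> k _; rewrite subr_gt0 xS.
Qed.

Lemma nodes_itv a b n x k : nodes a b n x -> (k <= n)%N -> a <= x k <= b.
Proof.
move=> [<- <- xS] kn; apply/andP; split.
  elim: k kn => // k IHk kn; exact: le_trans (IHk (ltnW kn)) (ltW (xS k kn)).
have -> : n = ((n - k) + k)%N by rewrite subnK.
have : (n - k + k <= n)%N by rewrite subnK.
elim: (n - k)%N => // l IHl ln.
exact: le_trans (IHl (ltnW ln)) (ltW (xS _ ln)).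
Qed.

Lemma nodes_locate a b n x t : nodes a b n x -> a <= t <= b ->
  t \notin [seq x k | k <- iota 0 n.+1] ->
  exists2 k, (k < n)%N & x k < t < x k.+1.
Proof.
move=> [xa xb xS] /andP[at_ tb] tx.
have x_neq k : (k <= n)%N -> x k != t.
  move=> kn; apply: contraNneq tx => <-.
  by apply: map_f; rewrite mem_iota add0n ltnS.
have ex_gt : exists j, t < x j.
  by exists n; rewrite lt_neqAle eq_sym x_neq // xb.
have := ex_minnP ex_gt => -[] [|k] tk k_min.
  by move: tk; rewrite xa ltNge at_.
have kn : (k < n)%N by apply: k_min; rewrite lt_neqAle eq_sym x_neq // xb.
exists k => //; rewrite tk lt_neqAle x_neq ?(ltnW kn) //= andbT leNgt.
by apply/negP => /k_min; rewrite ltnn.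
Qed.

(* With this extension the gap bounds hold for all indices; the values of [x]
   beyond [n] are arbitrary. *)
Definition extend_nodes n x m : R :=
  if (m <= n)%N then x m else x n + (m - n)%:R * min_gap n x.

Lemma extend_nodes_gap n x (c : R) m : 0 < min_gap n x -> 1 <= c ->
  max_gap n x <= c * min_gap n x ->
  min_gap n x <= extend_nodes n x m.+1 - extend_nodes n x m <= c * min_gap n x.
Proof.
move=> dl0 c1 gapc; rewrite /extend_nodes; case: (ltngtP m n) => mn.
- by rewrite min_gap_le //= (le_trans (max_gap_ge _ mn)).
- rewrite (subSn (ltnW mn)) -natr1 mulrDl mul1r.
  have -> : forall u v w : R, u + (v + w) - (u + v) = w by move=> u v w; ring.
  by rewrite lexx ler_peMl // ltW.
- rewrite mn subSnn mul1r addrC addKr lexx.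
  by rewrite ler_peMl // ltW.
Qed.

Lemma fh_weight_extend d g n x i t : (i + d <= n)%N ->
  fh_weight d g (extend_nodes n x) i t = fh_weight d g x i t.
Proof.
move=> idn; congr (_ * _); apply: eq_big_nat => j /andP[_ jd].
by rewrite /extend_nodes (leq_trans _ idn).
Qed.

Lemma interpolates_extend d n x f i (p : {poly R}) : (i + d <= n)%N ->
  interpolates d x f i p -> interpolates d (extend_nodes n x) f i p.
Proof.
move=> idn [sp px]; split=> // j ij; rewrite /extend_nodes.
by case/andP: (ij) => _ jd; rewrite (leq_trans jd idn) px.
Qed.

Lemma fh_interpolant_error_le a b (alpha c M : R) (f : R -> R) d g n x t :
  a < b -> 0 < alpha <= 1 -> 1 <= c -> 0 < M ->
  (forall s u, a <= s <= b -> a <= u <= b ->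
     `|f s - f u| <= M * `|s - u| `^ alpha) ->
  (1 <= d)%N -> (2 <= g)%N -> (d <= n)%N -> nodes a b n x ->
  max_gap n x <= c * min_gap n x -> min_gap n x <= c / n%:R ->
  a <= t <= b ->
  `|f t - fh_interpolant d g n x f t|
  <= 4 * M * (c + 1) * c ^+ 4 * (8 * c ^+ 2) ^+ d / n%:R `^ alpha.
Proof.
move=> ab alpha_itv c1 M0 fL d1 g2 dn xn gapc gapn tab.
have c0 : 0 < c by exact: lt_le_trans c1.
have n0 : 0 < n%:R :> R by rewrite ltr0n (leq_trans d1).
have bound_ge0 : 0 <= 4 * M * (c + 1) * c ^+ 2 * (8 * c ^+ 2) ^+ d.
  by rewrite !mulr_ge0 ?exprn_ge0 ?mulr_ge0 ?exprn_ge0 ?addr_ge0 // ltW.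
rewrite /fh_interpolant; case: ifPn => [_|tx].
  rewrite subrr normr0 (_ : c ^+ 4 = c ^+ 2 * c ^+ 2); last by rewrite -exprD.
  rewrite divr_ge0 ?powR_ge0 // mulrA mulrAC mulr_ge0 ?exprn_ge0 // ltW //.
have dl0 := min_gap_gt0 ab xn.
have [k kn tk] := nodes_locate xn tab tx.
pose y := extend_nodes n x.
have yE m : (m <= n)%N -> y m = x m by rewrite /y /extend_nodes => ->.
have y_ge m : min_gap n x <= y m.+1 - y m.
  by case/andP: (extend_nodes_gap m dl0 c1 gapc).
have y_le m : y m.+1 - y m <= c * min_gap n x.
  by case/andP: (extend_nodes_gap m dl0 c1 gapc).
have tky : y k < t < y k.+1 by rewrite !yE // ltnW.
(* Starting at k may overrun x_n; the cap n - d gives the last window, which still contains x_(k+1)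
   because k < n. *)
pose i0 := minn k (n - d).
have i0k : (i0 <= k)%N by exact: geq_minl.
have i0d : (k < i0 + d)%N by rewrite /i0; clear -kn dn d1; lia.
have i0N : (i0 < (n - d).+1)%N by rewrite ltnS geq_minr.
have quotE : fh_quotient d g n x f t =
    (\sum_(0 <= i < (n - d).+1) fh_weight d g y i t * (local_interp d x f i).[t])
    / \sum_(0 <= i < (n - d).+1) fh_weight d g y i t.
  rewrite /fh_quotient; congr (_ / _); apply: eq_big_nat => i /andP[_ iN];
    by rewrite fh_weight_extend //; clear -iN dn; lia.
rewrite quotE.
apply: le_trans (quotient_error_le dl0 c1 y_ge y_le tky d1 i0k i0d
  (M := M) (f := f) (p := local_interp d x f) alpha_itv (ltW M0) g2 i0N _ _) _.
- move=> i iN; have idn : (i + d <= n)%N by clear -iN dn; lia.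
  exact: interpolates_extend idn (interpolates_local_interp f xn idn).
- move=> j jN; have jn : (j <= n)%N by clear -jN dn; lia.
  by rewrite yE //; apply: fL => //; exact: nodes_itv xn jn.
(* The base is at most c^2 / n, and (c^2)^alpha <= c^2 since c >= 1 and alpha <= 1; this turns c^2
   into c^4 in the constant. *)
have powE : (c * min_gap n x) `^ alpha <= c ^+ 2 / n%:R `^ alpha.
  case/andP: alpha_itv => alpha0 alpha1.
  have -> : (n%:R `^ alpha)^-1 = n%:R^-1 `^ alpha :> R.
    by rewrite -powR_inv1 ?powR_ge0 // powRAC powR_inv1 ?ltW.
  apply: (@le_trans _ _ ((c ^+ 2 * n%:R^-1) `^ alpha)).
    apply: ge0_ler_powR; rewrite ?nnegrE ?(ltW alpha0) //.
    - by rewrite mulr_ge0 // ltW.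
    - by rewrite mulr_ge0 ?exprn_ge0 ?invr_ge0 // ltW.
    by rewrite expr2 -mulrA ler_wpM2l // ltW.
  rewrite powRM ?exprn_ge0 ?invr_ge0 ?(ltW c0) ?(ltW n0) //.
  by rewrite ler_wpM2r ?powR_ge0 // ler1_powR // exprn_ege1.
apply: le_trans (ler_wpM2l bound_ge0 powE) _.
rewrite (_ : c ^+ 4 = c ^+ 2 * c ^+ 2); last by rewrite -exprD.
by rewrite le_eqVlt; apply/orP; left; apply/eqP; ring.
Qed.

End Nodes.

(** * Choice of the constant and the two cases *)

Theorem theorem5p2 (R : realType) (a b alpha c1 c2 : R) (f : R -> R)
    (hab : a < b) (halpha : 0 < alpha <= 1) (hc1 : 0 < c1) (hc2 : 0 < c2)
    (hf : Lip alpha a b f) :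
  exists C : nat -> nat -> R,
    [/\ forall d gamma : nat, (1 <= d)%N -> (2 <= gamma)%N -> 0 < C d gamma,
        bounded_in_gamma C,
        exp_growing_in_d C &
        forall (d gamma n : nat) (x : nat -> R),
          (1 <= d)%N -> (2 <= gamma)%N -> (d <= n)%N ->
          nodes a b n x ->
          sim c1 c2 (max_gap n x) (min_gap n x) ->
          sim c1 c2 (min_gap n x) n%:R^-1 ->
          forall t : R, a <= t <= b ->
            (alpha + 1 < gamma%:R ->
               `|f t - fh_interpolant d gamma n x f t|
                 <= C d gamma * (1 / n%:R `^ alpha)) /\
            (gamma%:R = alpha + 1 -> (2 <= n)%N ->
               `|f t - fh_interpolant d gamma n x f t|
                 <= C d gamma * (ln n%:R / n%:R `^ alpha))].
Proof.
have [M M0 fL] := hf.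
(* A single constant that is at least 1 and dominates both mesh ratios. *)
pose c := 1 + c2; have c_ge1 : 1 <= c by rewrite lerDl ltW.
have c_gt0 : 0 < c by exact: lt_le_trans c_ge1.
pose K0 := 4 * M * (c + 1) * c ^+ 4; pose B := 8 * c ^+ 2.
have K0_gt0 : 0 < K0 by rewrite !mulr_gt0 ?exprn_gt0 // addr_gt0.
have B_gt1 : 1 < B.
  have : 1 <= c ^+ 2 by exact: exprn_ege1.
  by rewrite /B; lra.
have B_gt0 : 0 < B by exact: lt_trans B_gt1.
have ln2 : 0 < ln 2 :> R by rewrite ln_gt0 // ltr1n.
(* The summand 1 serves the case without logarithm; 1 / ln 2 serves the other, as ln n / ln 2 >= 1
   for n >= 2. *)
pose K := K0 * (1 + (ln 2)^-1).
have K_gt0 : 0 < K by rewrite mulr_gt0 // addr_gt0 // invr_gt0.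
(* The witness is constant in gamma and exactly geometric in d, so it serves as its own bounds. *)
exists (fun d _ => K * B ^+ d); split=> [d g _ _|d _||].
- by rewrite mulr_gt0 // exprn_gt0.
- by exists (K * B ^+ d).
- by exists K, B, K, B; split=> // d g _ _; rewrite lexx.
move=> d g n x d1 g2 dn xn /andP[_ gapc] /andP[_ gapn] t tab.
have dl0 := min_gap_gt0 hab xn.
have n0 : 0 < n%:R :> R by rewrite ltr0n (leq_trans d1).
have main : `|f t - fh_interpolant d g n x f t| <= K0 * B ^+ d / n%:R `^ alpha.
  apply: (fh_interpolant_error_le hab halpha c_ge1 M0 fL d1 g2 dn xn _ _ tab).
    move: gapc; rewrite ler_pdivrMr // => /le_trans; apply.
    by rewrite ler_wpM2r ?(ltW dl0) // lerDr.
  move: gapn; rewrite invrK => gapn; rewrite ler_pdivlMr //.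
  by apply: le_trans gapn _; rewrite lerDr.
have BX_ge0 : 0 <= B ^+ d by rewrite exprn_ge0 // ltW.
split=> [_|_ n2]; apply: le_trans main _.
  rewrite div1r ler_wpM2r ?invr_ge0 ?powR_ge0 // ler_wpM2r // ler_peMr ?(ltW K0_gt0) //.
  by rewrite lerDl invr_ge0 ltW.
rewrite [leRHS]mulrA ler_wpM2r ?invr_ge0 ?powR_ge0 // [leRHS]mulrAC ler_wpM2r //.
rewrite -mulrA ler_peMr ?(ltW K0_gt0) //.
have ln_le : ln 2 <= ln n%:R :> R by rewrite ler_ln ?posrE // ler_nat.
rewrite mulrDl mul1r -[leLHS]add0r lerD ?(le_trans (ltW ln2)) //.
by rewrite ler_pdivlMl // mulr1.
Qed.
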